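(* Let $S$ be a band semigroup and let $\omega$ be a weight on $S$. Then the following are equivalent: (i) $\ell^{1}(S,\omega)$ is amenable; (ii) $S$ is finite and each $\tau$-class of $S$ is a singleton; (iii) $\ell^{1}(S)$ is amenable; (iv) $S$ is a finite semilattice.
   Context: A band semigroup is a semigroup $S$ with $s^2=s$ for all $s\in S$; a semilattice is a commutative band semigroup. Let $S^1$ be $S$ with an identity adjoined; the equivalence relation $\tau$ on $S$ is given by $s\,\tau\,t$ iff $S^1sS^1=S^1tS^1$. A weight on $S$ is a function $\omega:S\to(0,\infty)$ with $\omega(st)\le\omega(s)\omega(t)$. The Beurling algebra $\ell^{1}(S,\omega)$ is the space of $f=\sum_s f(s)\delta_s$ with $\|f\|_\omega=\sum_s|f(s)|\omega(s)<\infty$, with convolution $\delta_s*\delta_t=\delta_{st}$; $\ell^1(S)$ is the case $\omega\equiv1$. A Banach algebra $\mathcal{A}$ is amenable if for every Banach $\mathcal{A}$-bimodule $E$, every bounded derivation $\mathcal{A}\to E^*$ is inner. *)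

(* Defs.v *)
From HB Require Import structures.
From mathcomp Require Import all_boot all_order all_algebra.
From mathcomp Require Import all_classical all_reals all_analysis.
From mathcomp Require Import complex.
Set Implicit Arguments. Unset Strict Implicit. Unset Printing Implicit Defensive.
Import Order.TTheory GRing.Theory Num.Theory ComplexField.
Import numFieldNormedType.Exports.
Local Open Scope classical_set_scope.
Local Open Scope ring_scope.

Definition associative_op (S : Type) (mul : S -> S -> S) :=
  forall a b c, mul a (mul b c) = mul (mul a b) c.

Definition is_band (S : Type) (mul : S -> S -> S) :=
  associative_op mul /\ forall s, mul s s = s.

Definition is_semilattice (S : Type) (mul : S -> S -> S) :=
  is_band mul /\ forall s t, mul s t = mul t s.

(* principal two-sided ideal S^1 s S^1 = {s} u Ss u sS u SsS *)
Definition principal_ideal (S : Type) (mul : S -> S -> S) (s : S) : set S :=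
  [set u | u = s \/ (exists a, u = mul a s) \/ (exists b, u = mul s b)
           \/ (exists a b, u = mul (mul a s) b)].

Definition tau_rel (S : Type) (mul : S -> S -> S) (s t : S) : Prop :=
  principal_ideal mul s = principal_ideal mul t.

Definition tau_classes_singletons (S : Type) (mul : S -> S -> S) : Prop :=
  forall s t, tau_rel mul s t -> s = t.

Definition is_weight (R : realType) (S : Type) (mul : S -> S -> S)
  (omega : S -> R) : Prop :=
  (forall s, 0 < omega s) /\ (forall s t, omega (mul s t) <= omega s * omega t).

Section NetSums.
Import fintype bigop finmap.
Local Open Scope fset_scope.

Definition totally {I : choiceType} : set_system {fset I} :=
  filter_from setT (fun A => [set B | A `<=` B]).

Definition partial_sum {I : choiceType} {V : zmodType}
  (x : I -> V) (A : {fset I}) : V := (\sum_(i : A) x (val i))%R.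

Definition net_sum (I : choiceType) {K : numFieldType} {V : normedModType K}
  (x : I -> V) : V := lim (partial_sum x @ totally).
End NetSums.

Section Beurling.
Variable R : realType.
Local Notation C := R[i].
Variables (S : choiceType) (mul : S -> S -> S) (omega : S -> R).

Definition wabs (f : S -> C) : S -> C := fun s => `|f s| * (omega s)%:C%C.

Definition in_l1w (f : S -> C) : Prop :=
  exists M : R, forall J, partial_sum (wabs f) J <= M%:C%C.

Definition l1w_norm (f : S -> C) : C := net_sum (K := C) (V := C^o) (wabs f).

Definition l1_conv (f g : S -> C) : S -> C := fun u =>
  net_sum (K := C) (V := C^o) (fun p : S * S => if mul p.1 p.2 == u then f p.1 * g p.2 else 0).

Definition l1_add (f g : S -> C) : S -> C := fun s => f s + g s.
Definition l1_scale (c : C) (f : S -> C) : S -> C := fun s => c * f s.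

Definition l1_bimodule (E : completeNormedModType C)
  (la : (S -> C) -> E -> E) (ra : E -> (S -> C) -> E) : Prop :=
  [/\ (forall a, in_l1w a -> forall (c : C) (x y : E),
          la a (c *: x + y) = c *: la a x + la a y /\
          ra (c *: x + y) a = c *: ra x a + ra y a),
      (forall a b, in_l1w a -> in_l1w b -> forall (c : C) (x : E),
          la (l1_add (l1_scale c a) b) x = c *: la a x + la b x /\
          ra x (l1_add (l1_scale c a) b) = c *: ra x a + ra x b),
      (forall a b, in_l1w a -> in_l1w b -> forall x : E,
          [/\ la (l1_conv a b) x = la a (la b x),
              ra x (l1_conv a b) = ra (ra x a) b &
              la a (ra x b) = ra (la a x) b]) &
      exists M : R, forall a, in_l1w a -> forall x : E,
          `|la a x| <= M%:C%C * l1w_norm a * `|x| /\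
          `|ra x a| <= M%:C%C * l1w_norm a * `|x| ].

(* D : l^1(S,omega) -> E^* is a bounded derivation; elements of E^* are
   represented as (continuous) linear functionals E -> C, and E^* carries the
   dual bimodule structure (a.phi)(x) = phi(x.a), (phi.a)(x) = phi(a.x). *)
Definition bounded_derivation (E : completeNormedModType C)
  (la : (S -> C) -> E -> E) (ra : E -> (S -> C) -> E)
  (D : (S -> C) -> E -> C) : Prop :=
  [/\ (forall a, in_l1w a -> forall (c : C) (x y : E),
          D a (c *: x + y) = c * D a x + D a y),
      (forall a b, in_l1w a -> in_l1w b -> forall (c : C) (x : E),
          D (l1_add (l1_scale c a) b) x = c * D a x + D b x),
      (forall a b, in_l1w a -> in_l1w b -> forall x : E,
          D (l1_conv a b) x = D b (ra x a) + D a (la b x)) &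
      exists M : R, forall a, in_l1w a -> forall x : E,
          `|D a x| <= M%:C%C * l1w_norm a * `|x| ].

Definition inner_derivation (E : completeNormedModType C)
  (la : (S -> C) -> E -> E) (ra : E -> (S -> C) -> E)
  (D : (S -> C) -> E -> C) : Prop :=
  exists phi : E -> C,
    (forall (c : C) (x y : E), phi (c *: x + y) = c * phi x + phi y) /\
    (exists M : R, forall x : E, `|phi x| <= M%:C%C * `|x|) /\
    (forall a, in_l1w a -> forall x : E, D a x = phi (ra x a) - phi (la a x)).

Definition l1_amenable : Prop :=
  forall (E : completeNormedModType C)
         (la : (S -> C) -> E -> E) (ra : E -> (S -> C) -> E),
    l1_bimodule la ra ->
    forall D : (S -> C) -> E -> C,
      bounded_derivation la ra D -> inner_derivation la ra D.

End Beurling.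

(* Main.v *)
Require Import Defs.
From HB Require Import structures.
From mathcomp Require Import all_boot all_order all_algebra finmap.
From mathcomp Require Import all_classical all_reals all_analysis.
From mathcomp Require Import complex ring lra.
Import Order.TTheory GRing.Theory Num.Theory ComplexField.
Import numFieldNormedType.Exports.
Set Implicit Arguments. Unset Strict Implicit. Unset Printing Implicit Defensive.
Local Open Scope classical_set_scope.
Local Open Scope ring_scope.

(** A band weight satisfies [omega >= 1], so bounded functions on [S] pair with
l^1(S, omega).  If l^1(S, omega) is amenable, the derivation
[s |-> delta_(s,1) - delta_(1,s)] yields a virtual diagonal: a bounded
functional [m] on l^oo(S^1 x S^1) with [m F(sx, y) = m F(x, ys)] and
[m g(xy) = g(1)].  Evaluating [m] on indicator functions does the rest.

If [jkj = j] and [kjk = k], the test function [[xj = j][jyj = j]] shifted by [j]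
has value 1, and shifted by [k] it vanishes unless [jk = k]; symmetrically
[kj = k], so [j = k].  With [j = st] and [k = ts] this gives commutativity.

In a semilattice, let [X] be a finite set and, for [s] in [X], let [e_s] be the
indicator of [{x >= s | every t in X below x is below s}].  These have disjoint
supports, so [sum_s e_s(x) [y >= s]] is bounded by 1, while shifting by [s] turns
each summand into [[xy >= s]], of value 1; hence [#|X|] is at most the norm
of [m].

Conversely, on a finite semilattice a derivation is made inner one commuting
idempotent at a time. *)

Import Normc.

Local Notation "\nsum x" := (net_sum (K := _[i]) (V := _[i]^o) x)
  (at level 10, x at level 8).

(** * The complex modulus *)

Section ComplexNorm.
Variable R : realType.
Implicit Types z w : R[i].

Lemma ler_normcD z w : normc (z + w) <= normc z + normc w.
Proof. exact: le_normcD. Qed.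

Lemma normc_opp z : normc (- z) = normc z.
Proof. exact: normcN. Qed.

Lemma normc_ge0 z : 0 <= normc z.
Proof. by case: z => a b; rewrite /normc sqrtr_ge0. Qed.

Lemma normc_distC z w : normc (z - w) = normc (w - z).
Proof. by rewrite -normc_opp opprB. Qed.

Lemma ler_normcB z w : normc (z - w) <= normc z + normc w.
Proof. by rewrite -(normc_opp w) ler_normcD. Qed.

Lemma ler_normc_dist z w v : normc (z - v) <= normc (z - w) + normc (w - v).
Proof. by rewrite -(subrK w z) -addrA addrK ler_normcD. Qed.

Lemma ler_normc_sum (I : Type) (r : seq I) (P : pred I) (F : I -> R[i]) :
  normc (\sum_(i <- r | P i) F i) <= \sum_(i <- r | P i) normc (F i).
Proof.
elim/big_rec2: _ => [|i y z _ h]; first by rewrite normc0.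
by apply: le_trans (ler_normcD _ _) _; rewrite lerD2l.
Qed.

Lemma normc_real (r : R) : 0 <= r -> normc r%:C%C = r.
Proof. by move=> r0; rewrite /normc /= expr0n addr0 sqrtr_sqr ger0_norm. Qed.

Lemma norm_normc z : `|z| = (normc z)%:C%C. Proof. by []. Qed.

Lemma normc_Re z : `|complex.Re z| <= normc z.
Proof. by have := normc_ge_Re z; rewrite norm_normc lecR. Qed.

Lemma normc_Im z : `|complex.Im z| <= normc z.
Proof.
case: z => a b; rewrite /normc /= -(@sqrtr_sqr _ b) ler_wsqrtr //.
by rewrite lerDr sqr_ge0.
Qed.

Lemma normc_le_ReIm z : normc z <= `|complex.Re z| + `|complex.Im z|.
Proof.
case: z => a b; rewrite /normc /=.
rewrite -[leRHS]ger0_norm ?addr_ge0 // -sqrtr_sqr ler_wsqrtr //.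
rewrite sqrrD !real_normK ?num_real // addrAC lerDl.
by rewrite mulrn_wge0 // mulr_ge0.
Qed.

(** Real and imaginary parts are 1-Lipschitz for the modulus, so each converges along [F] by
    completeness of [R], and [normc_le_ReIm] reassembles the limits. *)
Lemma complex_cauchy_cvg (T : Type) (F : set_system T) (g : T -> R[i]) :
  ProperFilter F ->
  (forall e : R, 0 < e -> exists x0 : T, F [set t | normc (g t - g x0) <= e]) ->
  exists l : R[i], forall e : R, 0 < e -> F [set t | normc (g t - l) <= e].
Proof.
move=> FF gcauchy.
have real_cvg (h : R[i] -> R) : (forall z w, `|h z - h w| <= normc (z - w)) ->
    exists l, forall e : R, 0 < e -> F [set t | `|h (g t) - l| <= e].
  move=> hlip.
  have : cvg ((h \o g) @ F).
    apply: cauchy_cvg; apply: cauchy_exP => e e0.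
    (* Halving [e] turns the weak inequality of the hypothesis into the strict one of a ball. *)
    have [x0 Fx0] := gcauchy (e / 2) ltac:(by rewrite divr_gt0).
    exists (h (g x0)); rewrite /fmap /=; apply: filterS Fx0 => t /= gt.
    rewrite /ball /= distrC; apply: le_lt_trans (hlip _ _) _.
    by apply: le_lt_trans gt _; rewrite ltr_pdivrMr // ltr_pMr // ltr1n.
  move=> /cvg_ex [l] /cvgrPdist_le hl; exists l => e /hl.
  by apply: filterS => t /=; rewrite distrC.
have [a ha] : exists a, forall e : R, 0 < e ->
    F [set t | `|complex.Re (g t) - a| <= e].
  by apply: real_cvg => -[? ?] [? ?]; apply: le_trans (normc_Re _).
have [b hb] : exists b, forall e : R, 0 < e ->
    F [set t | `|complex.Im (g t) - b| <= e].
  by apply: real_cvg => -[? ?] [? ?]; apply: le_trans (normc_Im _).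
exists (a +i* b)%C => e e0.
have e2 : 0 < e / 2 by rewrite divr_gt0.
apply: filterS2 (ha _ e2) (hb _ e2) => t /= h1 h2.
apply: le_trans (normc_le_ReIm _) _.
rewrite (splitr e); apply: lerD; move: h1 h2; by case: (g t).
Qed.

End ComplexNorm.

(** * Absolutely summable families *)

Section Summation.
Variable R : realType.
Local Notation C := R[i].
Local Open Scope fset_scope.
Local Open Scope ring_scope.

Definition abs_summable (I : choiceType) (x : I -> C) :=
  exists M : R, forall A : {fset I}, \sum_(i <- A) normc (x i) <= M.

(** Convergence of the net of finite partial sums, with real [e]. As [net_sum] is a [lim], its value
    is informative only once such an [l] is known to exist. *)
Definition has_sum (I : choiceType) (x : I -> C) (l : C) :=
  forall e : R, 0 < e -> exists A : {fset I}, forall B : {fset I},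
    A `<=` B -> normc (\sum_(i <- B) x i - l) <= e.

Lemma totally_proper (I : choiceType) : ProperFilter (@totally I).
Proof.
eapply filter_from_proper; last by move=> A _; exists A; rewrite /= fsubset_refl.
apply: filter_fromT_filter; first by exists fset0.
by move=> A B /=; exists (A `|` B) => P /=; rewrite fsubUset => /andP[].
Qed.
Existing Instance totally_proper.

Lemma partial_sumE (I : choiceType) (V : zmodType) (x : I -> V) (A : {fset I}) :
  partial_sum x A = \sum_(i <- A) x i.
Proof. by rewrite /partial_sum big_seq_fsetE. Qed.

Lemma sum_fset_subset (I : choiceType) (V : zmodType) (x : I -> V)
    (A B : {fset I}) : A `<=` B ->
  \sum_(i <- B) x i = \sum_(i <- A) x i + \sum_(i <- B `\` A) x i.
Proof.
move=> AB; rewrite (big_fsetID _ (mem A)) /=; congr (_ + _); apply: eq_fbigl.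
- by move=> i; rewrite !inE /=; apply/andP/idP => [[]//|iA]; rewrite (fsubsetP AB).
- by move=> i; rewrite !inE /= andbC.
Qed.

Lemma ler_sum_fset_subset (I : choiceType) (x : I -> R) (A B : {fset I}) :
  (forall i, 0 <= x i) -> A `<=` B -> \sum_(i <- A) x i <= \sum_(i <- B) x i.
Proof.
by move=> x0 AB; rewrite (sum_fset_subset x AB) lerDl sumr_ge0.
Qed.

Lemma has_sumE (I : choiceType) (x : I -> C) l : has_sum x l -> \nsum x = l.
Proof.
move=> xl; apply: (@cvg_lim R[i]^o); first exact: norm_hausdorff.
apply/cvgrPdist_le => e; case: e => e b.
rewrite ltcE /= => /andP[/eqP -> e0].
have [A hA] := xl _ e0; exists A => // B /= AB.
by rewrite partial_sumE /= lecR normc_distC hA.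
Qed.

(** Take [A] with norm sum within [e] of the supremum over all finite sets; a set disjoint from [A]
    cannot add more than [e]. *)
Lemma abs_summable_tail (I : choiceType) (x : I -> C) (e : R) :
  abs_summable x -> 0 < e -> exists A : {fset I}, forall B,
  [disjoint A & B]%fset -> \sum_(i <- B) normc (x i) <= e.
Proof.
move=> [M hM] e0.
pose P := [set r | exists A : {fset I}, r = \sum_(i <- A) normc (x i)].
have supP : has_sup P.
  split; first by exists (\sum_(i <- fset0) normc (x i)); exists fset0.
  by exists M => _ [A ->]; apply: hM.
have [_ [A ->] hA] := sup_adherent e0 supP.
exists A => B dAB.
have : \sum_(i <- A `|` B) normc (x i) <= sup P.
  by apply: ub_le_sup; [case: supP | exists (A `|` B)].
rewrite (sum_fset_subset _ (fsubsetUl A B)).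
suff -> : (A `|` B) `\` A = B.
  by move: hA; rewrite ltrBlDr => /ltW h1 h2; have := le_trans h2 h1; rewrite lerD2l.
by rewrite fsetDUl fsetDv fset0U; apply/fsetDidPl; rewrite fdisjoint_sym.
Qed.

Lemma abs_summable_has_sum (I : choiceType) (x : I -> C) :
  abs_summable x -> has_sum x (\nsum x).
Proof.
move=> sx.
suff [l hl] : exists l, has_sum x l by rewrite (has_sumE hl).
have [|l hl] := @complex_cauchy_cvg R _ (@totally I)
    (fun A : {fset I} => \sum_(i <- A) x i) _.
  move=> e e0; have [A hA] := abs_summable_tail sx e0.
  exists A; exists A => // B /= AB.
  rewrite (sum_fset_subset _ AB) addrAC subrr add0r.
  apply: le_trans (ler_normc_sum _ _ _) _; apply: hA.
  by apply/fdisjointP => i iA; rewrite inE iA.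
by exists l => e /hl [A _ hA]; exists A => B /hA.
Qed.

Lemma has_sumD (I : choiceType) (x y : I -> C) lx ly :
  has_sum x lx -> has_sum y ly -> has_sum (fun i => x i + y i) (lx + ly).
Proof.
move=> hx hy e e0; have e2 : 0 < e / 2 by rewrite divr_gt0.
have [A hA] := hx _ e2; have [B hB] := hy _ e2.
exists (A `|` B) => D; rewrite fsubUset => /andP[AD BD].
rewrite big_split /= opprD addrACA (splitr e).
by apply: le_trans (ler_normcD _ _) _; rewrite lerD ?hA ?hB.
Qed.

Lemma has_sumZ (I : choiceType) (c : C) (x : I -> C) l :
  has_sum x l -> has_sum (fun i => c * x i) (c * l).
Proof.
move=> hx e e0.
have c1 : 0 < normc c + 1 by rewrite ltr_wpDl ?normc_ge0.
have [A hA] := hx (e / (normc c + 1)) ltac:(by rewrite divr_gt0).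
exists A => B AB; rewrite -mulr_sumr -mulrBr normcM.
apply: (@le_trans _ _ ((normc c + 1) * (e / (normc c + 1)))).
  by apply: ler_pM; rewrite ?normc_ge0 ?hA // lerDl.
by rewrite mulrCA divff ?mulr1 // gt_eqF.
Qed.

Lemma has_sum_fsupport (I : choiceType) (x : I -> C) (A : {fset I}) :
  (forall i, i \notin A -> x i = 0) -> has_sum x (\sum_(i <- A) x i).
Proof.
move=> xA e e0; exists A => B AB.
rewrite (sum_fset_subset _ AB) addrAC subrr add0r big1_fset ?normc0 1?ltW //.
by move=> i; rewrite inE => /andP[/xA].
Qed.

Lemma has_sum_norm_le (I : choiceType) (x : I -> C) l (M : R) :
  has_sum x l -> (forall A : {fset I}, \sum_(i <- A) normc (x i) <= M) ->
  normc l <= M.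
Proof.
move=> hx hM; apply/ler_addgt0Pr => e e0.
have [A /(_ _ (fsubset_refl A)) hA] := hx e e0.
rewrite -(subrK (\sum_(i <- A) x i) l).
apply: le_trans (ler_normcD _ _) _; rewrite addrC lerD //.
  by apply: le_trans (hM A); apply: ler_normc_sum.
by rewrite normc_distC.
Qed.

(** Partial sums of nonnegative terms increase with the finite set. This extracts real bounds from
    the complex-valued [l1w_norm]. *)
Lemma has_sum_nonneg (I : choiceType) (r : I -> R) l :
  (forall i, 0 <= r i) -> has_sum (fun i => (r i)%:C%C) l ->
  l = (complex.Re l)%:C%C /\
  forall A : {fset I}, \sum_(i <- A) r i <= complex.Re l.
Proof.
move=> r0 hr; split.
  suff Il : complex.Im l = 0 by case: l hr Il => a b /= _ ->.
  apply/eqP; rewrite -normr_le0; apply/ler_addgt0Pr => e e0.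
  have [A /(_ _ (fsubset_refl A)) hA] := hr e e0.
  rewrite add0r; apply: le_trans hA; apply: le_trans (normc_Im _).
  by rewrite -rmorph_sum raddfB /= sub0r normrN.
move=> A; apply/ler_addgt0Pr => e e0.
have [B hB] := hr e e0; have := hB _ (fsubsetUr A B).
rewrite -rmorph_sum => /(le_trans (normc_Re _)); rewrite raddfB /=.
rewrite ler_distl => /andP[_ h].
exact: le_trans (ler_sum_fset_subset r0 (fsubsetUl A B)) h.
Qed.

Lemma abs_summable_le (I : choiceType) (x y : I -> C) :
  abs_summable x -> (forall i, normc (y i) <= normc (x i)) -> abs_summable y.
Proof. by move=> [M hM] yx; exists M => A; apply: le_trans (hM A); apply: ler_sum. Qed.

Lemma abs_summableM (I : choiceType) (x h : I -> C) (K : R) :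
  abs_summable x -> (forall i, normc (h i) <= K) ->
  abs_summable (fun i => x i * h i).
Proof.
move=> [M hM] hK; exists (M * `|K|) => A.
apply: (@le_trans _ _ (\sum_(i <- A) normc (x i) * `|K|)).
  apply: ler_sum => i _; rewrite normcM ler_wpM2l ?normc_ge0 //.
  exact: le_trans (hK i) (ler_norm _).
by rewrite -mulr_suml ler_wpM2r.
Qed.

Lemma abs_summableZ (I : choiceType) (c : C) (x : I -> C) :
  abs_summable x -> abs_summable (fun i => c * x i).
Proof.
move=> sx; have -> : (fun i => c * x i) = (fun i => x i * c).
  by apply/funext => i; rewrite mulrC.
exact: (@abs_summableM _ _ (fun=> c) (normc c)).
Qed.

Lemma net_sumD (I : choiceType) (x y : I -> C) :
  abs_summable x -> abs_summable y ->
  \nsum (fun i => x i + y i) = \nsum x + \nsum y.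
Proof.
by move=> sx sy; apply: has_sumE; apply: has_sumD; apply: abs_summable_has_sum.
Qed.

Lemma net_sumZ (I : choiceType) (c : C) (x : I -> C) :
  abs_summable x -> \nsum (fun i => c * x i) = c * \nsum x.
Proof. by move=> sx; apply: has_sumE; apply: has_sumZ; apply: abs_summable_has_sum. Qed.

Lemma net_sum_norm_le (I : choiceType) (x : I -> C) (M : R) :
  (forall A : {fset I}, \sum_(i <- A) normc (x i) <= M) -> normc (\nsum x) <= M.
Proof.
move=> hM; apply: has_sum_norm_le (hM).
by apply: abs_summable_has_sum; exists M.
Qed.

Lemma net_sum1 (I : choiceType) (x : I -> C) (i0 : I) :
  (forall i, i != i0 -> x i = 0) -> \nsum x = x i0.
Proof.
move=> h; apply: has_sumE.
have := @has_sum_fsupport I x [fset i0]; rewrite big_seq_fset1; apply=> i.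
by rewrite inE; apply: h.
Qed.

(** * Summation by fibres *)

Section Fibres.
Variables (I U : choiceType) (p : I -> U).

Definition fibre_sum (x : I -> C) (u : U) : C :=
  \nsum (fun i => if p i == u then x i else 0).

Lemma abs_summable_if (P : pred I) (x : I -> C) :
  abs_summable x -> abs_summable (fun i => if P i then x i else 0).
Proof.
move=> /abs_summable_le; apply=> i.
by case: ifP; rewrite ?normc0 ?normc_ge0.
Qed.

Lemma sum_fibre_sum (x : I -> C) (J : {fset U}) : abs_summable x ->
  \sum_(u <- J) fibre_sum x u = \nsum (fun i => if p i \in J then x i else 0).
Proof.
move=> sx; symmetry; apply: has_sumE.
have -> : (fun i => if p i \in J then x i else 0) =
    (fun i => \sum_(u <- J) (if p i == u then x i else 0)).
  apply/funext => i; case: ifPn => [piJ|piJ].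
    rewrite (big_fsetD1 (p i)) //= eqxx big1_fset ?addr0 // => u.
    by rewrite !inE eq_sym => /andP[/negbTE ->].
  rewrite big1_fset // => u uJ _; case: eqP => // piu.
  by rewrite -piu (negbTE piJ) in uJ.
elim: (enum_fset J) => [|u s IH].
  rewrite big_nil; under eq_fun do rewrite big_nil.
  have := @has_sum_fsupport I (fun=> 0) fset0 (fun _ _ => erefl).
  by rewrite big_seq_fset0.
rewrite big_cons; under eq_fun do rewrite big_cons.
apply: has_sumD IH; apply: abs_summable_has_sum; exact: abs_summable_if.
Qed.

(** Regrouping along a map: for the coordinate projections this gives Fubini, for the multiplication
    of [S] the pairing with a convolution. *)
Lemma has_sum_fibre_sum (x : I -> C) :
  abs_summable x -> has_sum (fibre_sum x) (\nsum x).
Proof.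
move=> sx e e0; have [A hA] := abs_summable_tail sx e0.
(* Once [J] contains the image of [A], the error involves only indices outside [A]. *)
exists [fset p i | i in A] => J AJ.
rewrite sum_fibre_sum // -(opprK (_ - _)) opprB normc_opp.
have -> : \nsum x - \nsum (fun i => if p i \in J then x i else 0) =
    \nsum (fun i => if p i \in J then 0 else x i).
  apply/eqP; rewrite subr_eq -net_sumD; last 2 first.
  - by apply: abs_summable_le sx _ => i; case: ifP; rewrite ?normc0 ?normc_ge0.
  - exact: abs_summable_if.
  apply/eqP; congr (\nsum _); apply/funext => i.
  by case: ifP; rewrite ?add0r ?addr0.
apply: net_sum_norm_le => B; rewrite (big_fsetID _ (mem A)) /= big1_fset.
  rewrite add0r; apply: (@le_trans _ _ 
    (\sum_(i <- [fset i in B | i \notin A]) normc (x i))).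
    by apply: ler_sum => i _; case: ifP; rewrite ?normc0 ?normc_ge0.
  apply: hA; apply/fdisjointP => i iA; rewrite !inE /= iA andbF //.
move=> i; rewrite !inE /= => /andP[_ iA] _; rewrite ifT ?normc0 //.
by rewrite (fsubsetP AJ) // in_imfset.
Qed.

Lemma net_sum_fibre (x : I -> C) :
  abs_summable x -> \nsum (fibre_sum x) = \nsum x.
Proof. by move=> sx; apply: has_sumE; apply: has_sum_fibre_sum. Qed.

End Fibres.

(** A finite set of pairs lies in the rectangle of its two projections, where the sum factors. *)
Lemma prod_norm_le (I J : choiceType) (a : I -> C) (b : J -> C) (Ma Mb : R) :
  (forall A : {fset I}, \sum_(i <- A) normc (a i) <= Ma) ->
  (forall B : {fset J}, \sum_(j <- B) normc (b j) <= Mb) ->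
  forall D : {fset (I * J)}, \sum_(q <- D) normc (a q.1 * b q.2) <= Ma * Mb.
Proof.
move=> ha hb D.
pose A := [fset q.1 | q in D]; pose B := [fset q.2 | q in D].
have DAB : D `<=` A `*` B.
  by apply/fsubsetP => q qD; rewrite in_fsetM !in_imfset.
apply: le_trans (ler_sum_fset_subset _ DAB) _; first by move=> q; apply: normc_ge0.
have -> : \sum_(q <- A `*` B) normc (a q.1 * b q.2) =
    \sum_(i <- A) \sum_(j <- B) normc (a i * b j).
  transitivity (\sum_(q <- [seq (i, j) | i <- A, j <- B]) normc (a q.1 * b q.2));
    last by rewrite big_allpairs_dep.
  apply: perm_big; apply: uniq_perm; first exact: fset_uniq.
    by apply: allpairs_uniq; rewrite ?fset_uniq // => -[? ?] [? ?] _ _ [-> ->].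
  move=> [i j]; rewrite in_fsetM /=; apply/andP/allpairsP => [[iA jB]|].
    by exists (i, j).
  by move=> [[i' j'] /= [iA jB [-> ->]]].
apply: (@le_trans _ _ (\sum_(i <- A) (normc (a i) * Mb))).
  apply: ler_sum => i _; under eq_bigr do rewrite normcM.
  by rewrite -mulr_sumr ler_wpM2l ?normc_ge0.
rewrite -mulr_suml ler_wpM2r //.
by apply: le_trans (hb fset0); rewrite big_seq_fset0.
Qed.

(** Sum over the fibres of [fst], and inside each over the fibres of [snd], which meet it in one
    point. *)
Lemma net_sum_prod (I J : choiceType) (x : I * J -> C) : abs_summable x ->
  \nsum (fun i => \nsum (fun j => x (i, j))) = \nsum x.
Proof.
move=> sx; rewrite -(net_sum_fibre fst sx); congr (\nsum _).
apply/funext => i; rewrite /fibre_sum -(net_sum_fibre snd); last exact: abs_summable_if.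
congr (\nsum _); apply/funext => j; rewrite /fibre_sum.
rewrite (@net_sum1 _ _ (i, j)) /= ?eqxx // => -[i' j'] /= ne.
case: eqP => // ej; case: eqP => // ei.
by rewrite ej ei eqxx in ne.
Qed.

Lemma net_sum_prodC (I J : choiceType) (x : I * J -> C) : abs_summable x ->
  \nsum (fun j => \nsum (fun i => x (i, j))) = \nsum x.
Proof.
move=> sx; rewrite -(net_sum_fibre snd sx); congr (\nsum _).
apply/funext => j; rewrite /fibre_sum -(net_sum_fibre fst); last exact: abs_summable_if.
congr (\nsum _); apply/funext => i; rewrite /fibre_sum.
rewrite (@net_sum1 _ _ (i, j)) /= ?eqxx // => -[i' j'] /= ne.
case: eqP => // ei; case: eqP => // ej.
by rewrite ej ei eqxx in ne.
Qed.

End Summation.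

(** * The Banach space of bounded functions *)

Section BoundedFunctions.
Variables (R : realType) (T : Type).
Local Notation C := R[i].

Definition bounded_pred : {pred T -> C^o} :=
  fun f => `[< exists M : R, forall t, normc (f t) <= M >].

Lemma bounded_pred_submod : submod_closed bounded_pred.
Proof.
split; first by apply/asboolP; exists 0 => t; rewrite normc0.
move=> c f g /asboolP[M hM] /asboolP[N hN]; apply/asboolP.
exists (normc c * M + N) => t; apply: le_trans (ler_normcD _ _) _.
by rewrite lerD // normcM ler_wpM2l ?normc_ge0.
Qed.

HB.instance Definition _ :=
  GRing.isSubmodClosed.Build C (T -> C^o) bounded_pred bounded_pred_submod.

Record bfun := BFun { bval : T -> C^o; _ : bval \in bounded_pred }.
HB.instance Definition _ := [isSub for bval].
HB.instance Definition _ := [Choice of bfun by <:].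
HB.instance Definition _ := [SubChoice_isSubLmodule of bfun by <:].

Definition bnorm (f : bfun) : R := sup [set normc (bval f t) | t in [set: T]].

Lemma bvalD (f g : bfun) t : bval (f + g) t = bval f t + bval g t.
Proof. by []. Qed.

Lemma bvalN (f : bfun) t : bval (- f) t = - bval f t.
Proof. by []. Qed.

Lemma bvalZ (c : C) (f : bfun) t : bval (c *: f) t = c * bval f t.
Proof. by []. Qed.

Lemma bfun_eq (f g : bfun) : (forall t, bval f t = bval g t) -> f = g.
Proof. by move=> fg; apply: val_inj; apply/funext. Qed.

Lemma bval_le (f : bfun) t : normc (bval f t) <= bnorm f.
Proof.
apply: ub_le_sup; last by exists t.
have /asboolP[M hM] : bval f \in bounded_pred by case: f.
by exists M => _ [u _ <-].
Qed.

Lemma bnorm_le (f : bfun) (M : R) : 0 <= M ->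
  (forall t, normc (bval f t) <= M) -> bnorm f <= M.
Proof.
move=> M0 hM; rewrite /bnorm; set A := (X in sup X).
(* For empty [T] the supremum is over the empty set and defaults to 0, whence the hypothesis
   [0 <= M]. *)
have [->|/set0P A0] := eqVneq A set0; first by rewrite sup0.
by apply: ge_sup => // _ [t _ <-].
Qed.

Lemma bnorm_ge0 (f : bfun) : 0 <= bnorm f.
Proof.
rewrite /bnorm; set A := (X in sup X).
have [->|/set0P [_ [t _ _]]] := eqVneq A set0; first by rewrite sup0.
exact: le_trans (normc_ge0 _) (bval_le f t).
Qed.

Lemma bnormD (f g : bfun) :
  (bnorm (f + g))%:C%C <= (bnorm f)%:C%C + (bnorm g)%:C%C.
Proof.
rewrite -rmorphD lecR; apply: bnorm_le; first by rewrite addr_ge0 ?bnorm_ge0.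
by move=> t; apply: le_trans (ler_normcD _ _) _; rewrite lerD ?bval_le.
Qed.

Lemma bnormZ_le (c : C) (f : bfun) : bnorm (c *: f) <= normc c * bnorm f.
Proof.
apply: bnorm_le; first by rewrite mulr_ge0 ?normc_ge0 ?bnorm_ge0.
by move=> t; rewrite bvalZ normcM ler_wpM2l ?normc_ge0 ?bval_le.
Qed.

Lemma bnormZ (c : C) (f : bfun) :
  (bnorm (c *: f))%:C%C = `|c| * (bnorm f)%:C%C.
Proof.
rewrite norm_normc -rmorphM; congr (_ %:C%C); apply/eqP.
rewrite eq_le bnormZ_le /=; have [->|c0] := eqVneq c 0.
  by rewrite normc0 mul0r bnorm_ge0.
have nc : 0 < normc c.
  by rewrite lt_neqAle normc_ge0 andbT eq_sym; apply: contra c0 => /eqP/eq0_normc ->.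
(* The reverse inequality is [bnormZ_le] for [c^-1] and [c *: f]. *)
rewrite -ler_pdivlMl // -normcV.
by have := bnormZ_le c^-1 (c *: f); rewrite scalerA mulVf // scale1r.
Qed.

Lemma bnorm_eq0 (f : bfun) : (bnorm f)%:C%C = 0 -> f = 0.
Proof.
move=> [f0]; apply: bfun_eq => t; apply: eq0_normc; apply/eqP.
by rewrite eq_le normc_ge0 andbT -[leRHS]f0 bval_le.
Qed.

HB.instance Definition _ :=
  Lmodule_isNormed.Build C bfun bnormD bnormZ bnorm_eq0.

Lemma bfun_normE (f : bfun) : `|f| = (bnorm f)%:C%C. Proof. by []. Qed.

(** Pointwise limits exist by completeness of the complex numbers. The Cauchy condition is uniform
    in [t], so convergence is uniform and the limit is bounded. *)
Lemma bfun_complete (F : set_system bfun) :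
  ProperFilter F -> cauchy F -> cvg F.
Proof.
move=> FF /cauchyP Fc.
have FcR (e : R) : 0 < e -> exists f0, F [set f | bnorm (f - f0) <= e].
  move=> e0; have [|f0 h] := Fc e%:C%C; first by rewrite ltcR.
  exists f0; apply: filterS h => f; rewrite -ball_normE /= distrC.
  by rewrite bfun_normE ltcR => /ltW.
have ptc t : exists l : C, forall e : R, 0 < e ->
    F [set f | normc (bval f t - l) <= e].
  apply: complex_cauchy_cvg => e /FcR [f0 h]; exists f0.
  by apply: filterS h => f /=; apply: le_trans; apply: (bval_le (f - f0)).
have [l hl] := choice ptc.
have unif (e : R) : 0 < e ->
    F [set f | forall t, normc (bval f t - l t) <= e].
  move=> e0; have e2 : 0 < e / 4 by rewrite divr_gt0.
  have [f0 Ff0] := FcR _ e2.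
  apply: filterS (Ff0) => f /= ff0 t.
  (* The auxiliary [g] depends on [t], but the total of three errors [e / 4] does not. *)
  have [g [/= gf0 gl]] := filter_ex (filterI Ff0 (hl t _ e2)).
  apply: le_trans (ler_normc_dist _ (bval f0 t) _) _.
  apply: (@le_trans _ _ (e / 4 + (e / 4 + e / 4))).
    apply: lerD; first exact: le_trans (bval_le (f - f0) t) ff0.
    apply: le_trans (ler_normc_dist _ (bval g t) _) _.
    apply: lerD => //; rewrite normc_distC.
    exact: le_trans (bval_le (g - f0) t) gf0.
  have -> : e / 4 + (e / 4 + e / 4) = e * (3 / 4) by field.
  by rewrite ler_piMr ?ltW //; lra.
have lb : l \in bounded_pred.
  have /filter_ex [f hf] := unif 1 ltr01.
  apply/asboolP; exists (bnorm f + 1) => t.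
  rewrite -(subrK (bval f t) (l t)) addrC; apply: le_trans (ler_normcD _ _) _.
  by rewrite lerD ?bval_le // normc_distC.
apply/cvg_ex; exists (BFun lb); apply/cvgrPdist_le => -[e b].
rewrite ltcE /= => /andP[/eqP -> e0].
apply: filterS (unif e e0) => f /= hf.
rewrite bfun_normE lecR; apply: bnorm_le; first exact: ltW.
by move=> t; rewrite bvalD bvalN normc_distC.
Qed.

HB.instance Definition _ := Uniform_isComplete.Build bfun bfun_complete.

(* Junk value [0] when [f] is unbounded. *)
Definition mkbfun (f : T -> C) : bfun :=
  if pselect (f \in bounded_pred) is left h then BFun h else 0.

Lemma mkbfunE (f : T -> C) (M : R) :
  (forall t, normc (f t) <= M) -> bval (mkbfun f) = f.
Proof.
move=> hM; rewrite /mkbfun; case: pselect => // -[].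
by apply/asboolP; exists M.
Qed.

End BoundedFunctions.
Arguments mkbfun {R T} f.

(** * Pairing l^1 with bounded functions *)

Section Pairing.
Variables (R : realType) (S : choiceType).
Local Notation C := R[i].
Implicit Types (a b h : S -> C) (M K : R).

(** The duality between l^1 and l^oo; the actions and the derivation into the dual used below are
    all given by it. *)
Definition pairing a h : C :=
  \nsum (fun s => a s * h s).

Definition l1_bound a M := forall A : {fset S}, \sum_(s <- A) normc (a s) <= M.

Lemma l1_bound_ge0 a M : l1_bound a M -> 0 <= M.
Proof. by move=> /(_ fset0); rewrite big_seq_fset0. Qed.

Lemma pairing_summable a M h K : l1_bound a M ->
  (forall s, normc (h s) <= K) -> abs_summable (fun s => a s * h s).
Proof. by move=> aM; apply: abs_summableM; exists M. Qed.

Lemma pairing_le a M h K : l1_bound a M -> 0 <= K ->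
  (forall s, normc (h s) <= K) -> normc (pairing a h) <= M * K.
Proof.
move=> aM K0 hK; apply: net_sum_norm_le => A.
apply: (@le_trans _ _ (\sum_(s <- A) normc (a s) * K)).
  by apply: ler_sum => s _; rewrite normcM ler_wpM2l ?normc_ge0.
by rewrite -mulr_suml ler_wpM2r.
Qed.

Lemma pairing_linear_r a M h1 h2 K1 K2 (c : C) : l1_bound a M ->
  (forall s, normc (h1 s) <= K1) -> (forall s, normc (h2 s) <= K2) ->
  pairing a (fun s => c * h1 s + h2 s) = c * pairing a h1 + pairing a h2.
Proof.
move=> aM hK1 hK2; rewrite /pairing.
have s1 := pairing_summable aM hK1; have s2 := pairing_summable aM hK2.
rewrite -net_sumZ // -net_sumD //.
  by congr (\nsum _); apply/funext => s; rewrite mulrDr mulrCA.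
exact: abs_summableZ.
Qed.

Lemma pairingB a M h1 h2 K1 K2 : l1_bound a M ->
  (forall s, normc (h1 s) <= K1) -> (forall s, normc (h2 s) <= K2) ->
  pairing a h1 - pairing a h2 = pairing a (fun s => h1 s - h2 s).
Proof.
move=> aM hK1 hK2; rewrite addrC -mulN1r -(pairing_linear_r _ aM hK2 hK1).
by congr pairing; apply/funext => s; rewrite mulN1r addrC.
Qed.

Lemma pairing_splitD a M h h1 h2 K1 K2 : l1_bound a M ->
  (forall s, normc (h1 s) <= K1) -> (forall s, normc (h2 s) <= K2) ->
  (forall s, h s = h1 s + h2 s) -> pairing a h = pairing a h1 + pairing a h2.
Proof.
move=> aM hK1 hK2 hE; rewrite -[X in _ = X + _]mul1r.
rewrite -(pairing_linear_r 1 aM hK1 hK2).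
by congr pairing; apply/funext => s; rewrite hE mul1r.
Qed.

Lemma pairing_linear_l a b M N h K (c : C) : l1_bound a M -> l1_bound b N ->
  (forall s, normc (h s) <= K) ->
  pairing (l1_add (l1_scale c a) b) h = c * pairing a h + pairing b h.
Proof.
move=> aM bN hK; rewrite /pairing.
have s1 := pairing_summable aM hK; have s2 := pairing_summable bN hK.
rewrite -net_sumZ // -net_sumD //.
  by congr (\nsum _); apply/funext => s; rewrite /l1_add /l1_scale mulrDl mulrA.
exact: abs_summableZ.
Qed.

Lemma l1_bound_linear a b M N (c : C) : l1_bound a M -> l1_bound b N ->
  l1_bound (l1_add (l1_scale c a) b) (normc c * M + N).
Proof.
move=> aM bN A; rewrite /l1_add /l1_scale.
apply: (@le_trans _ _ (\sum_(s <- A) (normc c * normc (a s) + normc (b s)))).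
  by apply: ler_sum => s _; rewrite -normcM ler_normcD.
by rewrite big_split -mulr_sumr lerD // ler_wpM2l ?normc_ge0.
Qed.

Section Product.
Variables (a b : S -> C) (M N : R) (H : S -> S -> C) (K : R).
Hypotheses (aM : l1_bound a M) (bN : l1_bound b N).
Hypothesis HK : forall s t, normc (H s t) <= K.

Let x (q : S * S) := a q.1 * b q.2 * H q.1 q.2.

Let sx : abs_summable x.
Proof.
apply: abs_summableM (fun q => HK q.1 q.2).
by exists (M * N); apply: prod_norm_le.
Qed.

Lemma pairing_pairing :
  pairing a (fun s => pairing b (H s)) =
  \nsum x.
Proof.
rewrite -net_sum_prod // /pairing; congr (\nsum _); apply/funext => s.
rewrite -net_sumZ; last by apply: pairing_summable bN (HK s).
by congr (\nsum _); apply/funext => t; rewrite /x mulrA.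
Qed.

Lemma pairing_swap :
  pairing b (fun t => pairing a (fun s => H s t)) =
  pairing a (fun s => pairing b (H s)).
Proof.
rewrite pairing_pairing -net_sum_prodC // /pairing.
congr (\nsum _); apply/funext => t.
rewrite -net_sumZ; last by apply: pairing_summable aM (fun s => HK s t).
by congr (\nsum _); apply/funext => s; rewrite /x mulrA (mulrC (b t)).
Qed.

End Product.

Lemma pairing_fubini a b M N (H H' : S -> S -> C) K :
  l1_bound a M -> l1_bound b N -> (forall s t, normc (H s t) <= K) ->
  (forall s t, H s t = H' t s) ->
  pairing a (fun s => pairing b (H s)) = pairing b (fun t => pairing a (H' t)).
Proof.
move=> aM bN HK HH'; rewrite -(pairing_swap aM bN HK).
congr pairing; apply/funext => t; congr pairing; apply/funext => s.
exact: HH'.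
Qed.

(** Group the pairs [(s, t)] by their product; [h] is constant on each fibre. *)
Lemma pairing_conv (mul : S -> S -> S) a b M N h K :
  l1_bound a M -> l1_bound b N -> (forall s, normc (h s) <= K) ->
  pairing (l1_conv mul a b) h =
  pairing a (fun s => pairing b (fun t => h (mul s t))).
Proof.
move=> aM bN hK.
have hK2 s t : normc (h (mul s t)) <= K by [].
rewrite (pairing_pairing aM bN hK2).
have sab : abs_summable (fun q : S * S => a q.1 * b q.2).
  by exists (M * N); apply: prod_norm_le.
rewrite -(net_sum_fibre (fun q => mul q.1 q.2)); last first.
  by apply: abs_summableM sab (fun q => hK2 q.1 q.2).
rewrite /pairing; congr (\nsum _); apply/funext => u.
rewrite /l1_conv mulrC -net_sumZ; last exact: abs_summable_if.
congr (\nsum _); apply/funext => q.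
by case: eqP => [->|_]; rewrite ?mulr0 // mulrC.
Qed.

Definition point_mass (s : S) : S -> C := fun t => if t == s then 1 else 0.

Lemma pairing_point_mass s h : pairing (point_mass s) h = h s.
Proof.
rewrite /pairing (@net_sum1 _ _ _ s) /point_mass ?eqxx ?mul1r // => t /negbTE ->.
by rewrite mul0r.
Qed.

Lemma point_mass_in_l1w (omega : S -> R) s : in_l1w omega (point_mass s).
Proof.
exists (`|omega s|) => J; rewrite partial_sumE /wabs /point_mass.
apply: (@le_trans _ _ (\sum_(i <- J) (if i == s then `|omega s| else 0))%:C%C).
  rewrite rmorph_sum; apply: ler_sum => i _; case: eqP => [->|_].
    by rewrite normr1 mul1r lecR ler_norm.
  by rewrite normr0 mul0r.
rewrite lecR; have [sJ|sJ] := boolP (s \in J).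
  rewrite (big_fsetD1 s) //= eqxx big1_fset ?addr0 // => i.
  by rewrite !inE => /andP[/negbTE ->].
rewrite big1_fset // => i iJ _; case: eqP => // is_.
by rewrite -is_ iJ in sJ.
Qed.

(** As [omega >= 1], the weighted sums dominate the unweighted ones, so pairings with bounded
    functions are controlled by the weighted norm. *)
Lemma in_l1w_bound (omega : S -> R) a : (forall s, 1 <= omega s) ->
  in_l1w omega a ->
  l1w_norm omega a = (complex.Re (l1w_norm omega a))%:C%C /\
  l1_bound a (complex.Re (l1w_norm omega a)).
Proof.
move=> w1 [M hM]; pose r s := normc (a s) * omega s.
have w0 s : 0 <= omega s by apply: le_trans (w1 s).
have r0 s : 0 <= r s by rewrite mulr_ge0 ?normc_ge0.
have wE : wabs omega a = (fun s => (r s)%:C%C).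
  by apply/funext => s; rewrite /wabs norm_normc -rmorphM.
have hs : has_sum (fun s => (r s)%:C%C) (l1w_norm omega a).
  rewrite /l1w_norm wE; apply: abs_summable_has_sum; exists M => A.
  have := hM A; rewrite partial_sumE wE -rmorph_sum lecR.
  by apply: le_trans; apply: ler_sum => s _; rewrite normc_real.
have [hRe hA] := has_sum_nonneg r0 hs; split=> // A.
by apply: le_trans (hA A); apply: ler_sum => s _; rewrite ler_peMr ?normc_ge0.
Qed.

End Pairing.

(** * Actions on bounded functions by differences of two translations *)

Section DifferenceAction.
Variables (R : realType) (S : choiceType) (P : Type).
Local Notation C := R[i].
Local Notation E := (bfun R P).

(** The common shape of the left and right actions below, so that linearity, bounds and compositions
    are treated once for arbitrary [q1] and [q2]. *)
Definition diff_act (q1 q2 : S -> P -> P) (a : S -> C) (F : E) : E :=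
  mkbfun (fun p => pairing a (fun s => bval F (q1 s p) - bval F (q2 s p))).

Lemma bvalB_le (F : E) p p' : normc (bval F p - bval F p') <= bnorm F *+ 2.
Proof. by apply: le_trans (ler_normcB _ _) _; rewrite mulr2n lerD ?bval_le. Qed.

Lemma bvalBB_le (F : E) p1 p2 p3 p4 :
  normc (bval F p1 - bval F p2 - (bval F p3 - bval F p4)) <= bnorm F *+ 2 *+ 2.
Proof.
by apply: le_trans (ler_normcB _ _) _; rewrite [leRHS]mulr2n lerD ?bvalB_le.
Qed.

Lemma bnorm2_ge0 (F : E) : 0 <= bnorm F *+ 2.
Proof. by rewrite mulrn_wge0 ?bnorm_ge0. Qed.

Variables q1 q2 : S -> P -> P.

Lemma diff_act_val a M F p : l1_bound a M ->
  bval (diff_act q1 q2 a F) p =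
  pairing a (fun s => bval F (q1 s p) - bval F (q2 s p)).
Proof.
move=> aM; rewrite (@mkbfunE _ _ _ (M * (bnorm F *+ 2))) // => t.
by apply: pairing_le (bnorm2_ge0 F) _ => // s; apply: bvalB_le.
Qed.

Lemma diff_act_le a M F : l1_bound a M ->
  bnorm (diff_act q1 q2 a F) <= 2 * M * bnorm F.
Proof.
move=> aM; have M0 := l1_bound_ge0 aM.
apply: bnorm_le => [|p]; first by rewrite !mulr_ge0 ?bnorm_ge0.
rewrite (diff_act_val _ _ aM) -mulrA mulrCA mulr_natl.
by apply: pairing_le (bnorm2_ge0 F) _ => // s; apply: bvalB_le.
Qed.

Lemma diff_act_linear_r a M (c : C) F G : l1_bound a M ->
  diff_act q1 q2 a (c *: F + G) = c *: diff_act q1 q2 a F + diff_act q1 q2 a G.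
Proof.
move=> aM; apply: bfun_eq => p; rewrite bvalD bvalZ !(diff_act_val _ _ aM).
rewrite -(@pairing_linear_r _ _ _ _ _ _ _ _ c aM (fun s => bvalB_le F _ _)
  (fun s => bvalB_le G _ _)).
by congr pairing; apply/funext => s; rewrite !bvalD !bvalZ; ring.
Qed.

Lemma diff_act_linear_l a b M N (c : C) F : l1_bound a M -> l1_bound b N ->
  diff_act q1 q2 (l1_add (l1_scale c a) b) F =
  c *: diff_act q1 q2 a F + diff_act q1 q2 b F.
Proof.
move=> aM bN; apply: bfun_eq => p; rewrite bvalD bvalZ.
rewrite (diff_act_val _ _ aM) (diff_act_val _ _ bN).
rewrite (diff_act_val _ _ (l1_bound_linear c aM bN)).
exact: pairing_linear_l aM bN (fun s => bvalB_le F _ _).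
Qed.

Lemma diff_act_diff (q1' q2' : S -> P -> P) b N F p p' : l1_bound b N ->
  bval (diff_act q1' q2' b F) p - bval (diff_act q1' q2' b F) p' =
  pairing b (fun t => bval F (q1' t p) - bval F (q2' t p)
                      - (bval F (q1' t p') - bval F (q2' t p'))).
Proof.
move=> bN; rewrite /= !(mkbfunE (M := N * (bnorm F *+ 2))); first last.
- by move=> t; apply: pairing_le (bnorm2_ge0 F) _ => // s; apply: bvalB_le.
by rewrite (pairingB bN (fun s => bvalB_le F _ _) (fun s => bvalB_le F _ _)).
Qed.

Lemma diff_act_comp (q1' q2' : S -> P -> P) a b M N F p :
  l1_bound a M -> l1_bound b N ->
  bval (diff_act q1 q2 a (diff_act q1' q2' b F)) p =
  pairing a (fun s => pairing b (fun t =>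
    bval F (q1' t (q1 s p)) - bval F (q2' t (q1 s p))
    - (bval F (q1' t (q2 s p)) - bval F (q2' t (q2 s p))))).
Proof.
move=> aM bN; rewrite (diff_act_val _ _ aM); congr pairing.
by apply/funext => s; rewrite (diff_act_diff _ _ _ _ _ bN).
Qed.

Lemma diff_act_conv (mul : S -> S -> S) a b M N F p :
  l1_bound a M -> l1_bound b N ->
  bval (diff_act q1 q2 (l1_conv mul a b) F) p =
  pairing a (fun s => pairing b (fun t =>
    bval F (q1 (mul s t) p) - bval F (q2 (mul s t) p))).
Proof.
move=> aM bN.
have E p' : pairing (l1_conv mul a b)
      (fun s => bval F (q1 s p') - bval F (q2 s p')) =
    pairing a (fun s => pairing b (fun t =>
      bval F (q1 (mul s t) p') - bval F (q2 (mul s t) p'))).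
  exact: pairing_conv aM bN (fun s => bvalB_le F _ _).
rewrite (@mkbfunE _ _ _ (M * (N * (bnorm F *+ 2)))) // => p'; rewrite E.
have N0 := l1_bound_ge0 bN.
apply: pairing_le => // [|s]; first by rewrite mulr_ge0 ?bnorm2_ge0.
by apply: pairing_le (bnorm2_ge0 F) _ => // t; apply: bvalB_le.
Qed.

End DifferenceAction.

(** * The virtual diagonal *)

Section AdjoinIdentity.
Variables (S : Type) (mul : S -> S -> S).

(** The monoid S^1, with [None] as the adjoined identity. *)
Definition omul (x y : option S) : option S :=
  match x, y with
  | None, _ => y
  | _, None => x
  | Some s, Some t => Some (mul s t)
  end.

Lemma omul1 x : omul x None = x. Proof. by case: x. Qed.

Lemma omulA : associative_op mul -> associative_op omul.
Proof. by move=> mulA [a|] [b|] [c|] //=; rewrite mulA. Qed.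

Lemma omul_idem : is_band mul -> forall x, omul x x = x.
Proof. by move=> [_ idem] [a|] //=; rewrite idem. Qed.

End AdjoinIdentity.

(** Cancel [omega s] in [omega s = omega (mul s s) <= omega s * omega s]. *)
Lemma band_weight_ge1 (R : realType) (S : Type) (mul : S -> S -> S)
    (omega : S -> R) :
  is_band mul -> is_weight mul omega -> forall s, 1 <= omega s.
Proof.
move=> [_ idem] [w0 wM] s; have := wM s s.
by rewrite idem -[leLHS]mulr1 ler_pM2l.
Qed.

Section VirtualDiagonal.
Variables (R : realType) (S : choiceType) (mul : S -> S -> S).
Variable omega : S -> R.
Hypotheses (mulA : associative_op mul) (omega_ge1 : forall s, 1 <= omega s).
Local Notation C := R[i].
Local Notation B := (option S * option S)%type.
Local Notation E := (bfun R B).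
Local Notation "x ** y" := (omul mul x y) (at level 40, left associativity).

(* The module is a model of the quotient of l^oo(S^1 x S^1) by the functions
   of the product [x ** y]: translations are followed by the projection
   [F |-> F(x, y) - F(1, xy)], whose kernel these functions are.  Its dual
   contains the kernel of the product map of the projective tensor square. *)
Definition diag_lact : (S -> C) -> E -> E :=
  diff_act (fun s p => (p.1, p.2 ** Some s))
           (fun s p => (None, p.1 ** p.2 ** Some s)).

Definition diag_ract (F : E) (a : S -> C) : E :=
  diff_act (fun s p => (Some s ** p.1, p.2))
           (fun s p => (Some s, p.1 ** p.2)) a F.

(** The commutator of [s] with the point mass at [(1, 1)]. It kills functions of the product,
    whereas that point mass does not. *)
Definition diag_der (a : S -> C) (F : E) : C :=
  pairing a (fun s => bval F (Some s, None) - bval F (None, Some s)).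

Let bound a (ha : in_l1w omega a) := proj2 (in_l1w_bound omega_ge1 ha).

Lemma diag_bimodule : l1_bimodule mul omega diag_lact diag_ract.
Proof.
have oA := omulA mulA.
split.
- by move=> a /bound aM c F G; split; apply: diff_act_linear_r aM.
- by move=> a b /bound aM /bound bN c F; split; apply: diff_act_linear_l aM bN.
- move=> a b /bound aM /bound bN F; split; apply: bfun_eq => p.
  (* Of the four translates in the composite, three are F(1, xyst), and two of these cancel. *)
  + rewrite (diff_act_conv _ _ _ _ _ aM bN) (diff_act_comp _ _ _ _ _ _ aM bN).
    congr pairing; apply/funext => s; congr pairing; apply/funext => t /=.
    by rewrite !oA -/(Some s ** Some t) !oA; ring.
  (* Here [b] is the outer operator, so the pairings come in the opposite order to those of the
     convolution. *)
  + rewrite (diff_act_conv _ _ _ _ _ aM bN) (diff_act_comp _ _ _ _ _ _ bN aM).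
    apply: (pairing_fubini aM bN (fun s t => bvalB_le F _ _)) => s t.
    by case: p => -[x|] [y|] /=; rewrite ?mulA; ring.
  + rewrite (diff_act_comp _ _ _ _ _ _ aM bN) (diff_act_comp _ _ _ _ _ _ bN aM).
    apply: (pairing_fubini aM bN (fun s t => bvalBB_le F _ _ _ _)) => s t.
    by case: p => -[x|] [y|] /=; rewrite ?mulA; ring.
- exists 2 => a ha F; have [-> aM] := in_l1w_bound omega_ge1 ha.
  by rewrite !bfun_normE -!rmorphM !lecR; split; apply: diff_act_le.
Qed.

Lemma diag_derivation : bounded_derivation mul omega diag_lact diag_ract diag_der.
Proof.
have oA := omulA mulA; rewrite /diag_der.
split.
- move=> a /bound aM c F G.
  rewrite -(pairing_linear_r c aM (fun s => bvalB_le F _ _)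
    (fun s => bvalB_le G _ _)).
  by congr pairing; apply/funext => s; rewrite !bvalD !bvalZ; ring.
- move=> a b /bound aM /bound bN c F.
  exact: pairing_linear_l aM bN (fun s => bvalB_le F _ _).
- move=> a b /bound aM /bound bN F.
  rewrite (pairing_conv mul aM bN (fun s => bvalB_le F _ _)).
  under [X in _ = pairing b X + _]eq_fun do rewrite (diff_act_diff _ _ _ _ _ aM).
  under [X in _ = _ + pairing a X]eq_fun do rewrite (diff_act_diff _ _ _ _ _ bN).
  (* The right action contributes F(st, 1) - F(s, t), written with three copies of F(s, t); the left
     action contributes F(s, t) - F(1, st). *)
  rewrite -(pairing_fubini aM bN (fun s t => bvalBB_le F
    (Some s ** Some t, None) (Some s, Some t) (Some s, Some t) (Some s, Some t))
    (fun s t => erefl _)).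
  have leb (p1 p2 p3 p4 : S -> B) : normc (pairing b (fun t =>
      bval F (p1 t) - bval F (p2 t) - (bval F (p3 t) - bval F (p4 t))))
      <= complex.Re (l1w_norm omega b) * (bnorm F *+ 2 *+ 2).
    apply: pairing_le => // [|t]; first by rewrite mulrn_wge0 ?bnorm2_ge0.
    exact: bvalBB_le.
  apply: (pairing_splitD aM) => [s|s|s].
  + exact: leb.
  + exact: leb.
  apply: (pairing_splitD bN) => [t|t|t /=].
  + exact: bvalBB_le.
  + exact: bvalBB_le.
  by ring.
- exists 2 => a ha F; have [-> aM] := in_l1w_bound omega_ge1 ha.
  rewrite norm_normc bfun_normE -!rmorphM lecR -mulrA mulrCA mulr_natl.
  by apply: pairing_le (bnorm2_ge0 F) _ => // s; apply: bvalB_le.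
Qed.

(** The third clause says that [m] commutes with [s], the fourth that the product map sends [m] to
    the point mass at the identity. Translates are given by their values, which avoids constructing
    them as bounded functions. *)
Definition virtual_diagonal (m : E -> C) : Prop :=
  [/\ forall (c : C) F G, m (c *: F + G) = c * m F + m G,
      exists K : R, forall F, normc (m F) <= K * bnorm F,
      forall (s : S) (F F1 F2 : E),
        (forall x y, bval F1 (x, y) = bval F (Some s ** x, y)) ->
        (forall x y, bval F2 (x, y) = bval F (x, y ** Some s)) ->
        m F1 = m F2 &
      forall (g : option S -> C) (F : E),
        (forall x y, bval F (x, y) = g (x ** y)) -> m F = g None].

(** If [phi] implements [diag_der] and [P] is the projection killing functions of the product,
    subtract [phi] composed with [P] from evaluation at [(1, 1)]: the commutators with each [s]
    cancel, and the value on functions of the product is unchanged. *)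
Lemma amenable_virtual_diagonal :
  l1_amenable mul omega -> exists m, virtual_diagonal m.
Proof.
have oA := omulA mulA.
move=> /(_ _ _ _ diag_bimodule _ diag_derivation) [phi [phi_lin [[K phi_le] phi_in]]].
have phi_leR F : normc (phi F) <= K * bnorm F.
  by have := phi_le F; rewrite norm_normc bfun_normE -rmorphM lecR.
pose P (F : E) : E := mkbfun (fun p => bval F p - bval F (None, p.1 ** p.2)).
have PE F p : bval (P F) p = bval F p - bval F (None, p.1 ** p.2).
  by rewrite (@mkbfunE _ _ _ (bnorm F *+ 2)) // => q; apply: bvalB_le.
have P_lin (c : C) F G : P (c *: F + G) = c *: P F + P G.
  apply: bfun_eq => p; rewrite bvalD bvalZ !PE !bvalD !bvalZ.
  by ring.
exists (fun F => bval F (None, None) - phi (P F)); split.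
- by move=> c F G; rewrite P_lin phi_lin bvalD bvalZ; ring.
- exists (1 + `|K| * 2) => F; apply: le_trans (ler_normcB _ _) _.
  rewrite mulrDl mul1r lerD ?bval_le //; apply: le_trans (phi_leR _) _.
  apply: (@le_trans _ _ (`|K| * bnorm (P F))).
    by rewrite ler_wpM2r ?bnorm_ge0 ?ler_norm.
  rewrite -mulrA ler_wpM2l // mulr_natl; apply: bnorm_le (bnorm2_ge0 F) _ => p.
  by rewrite PE bvalB_le.
- move=> s F F1 F2 F1E F2E.
  have in_s := point_mass_in_l1w omega s.
  have := phi_in _ in_s F; rewrite /diag_der pairing_point_mass.
  have -> : diag_ract F (point_mass R s) = P F1.
    apply: bfun_eq => -[x y]; rewrite (diff_act_val _ _ _ _ (bound in_s)).
    by rewrite pairing_point_mass PE !F1E.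
  have -> : diag_lact (point_mass R s) F = P F2.
    apply: bfun_eq => -[x y]; rewrite (diff_act_val _ _ _ _ (bound in_s)).
    by rewrite pairing_point_mass PE !F2E.
  rewrite F1E F2E omul1 /= => e; apply/eqP; rewrite -subr_eq0; apply/eqP.
  transitivity ((bval F (Some s, None) - bval F (None, Some s))
    - (phi (P F1) - phi (P F2))); first by ring.
  by rewrite e subrr.
- move=> g F FE.
  have -> : P F = 0.
    apply: bfun_eq => -[x y]; rewrite PE !FE /= subrr.
    by have := bvalZ 0 F (x, y); rewrite scale0r mul0r.
  have := phi_lin (-1) 0 0; rewrite scaler0 addr0 mulN1r addNr => ->.
  by rewrite FE subr0.
Qed.

End VirtualDiagonal.

(** * Consequences for bands *)

(** It makes the indicator of [jxj = j] multiplicative in [x], so a product of two such tests in [x]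
    and [y] is a function of [xy]. *)
Lemma band_sandwichM (T : Type) (mul : T -> T -> T) (j x y : T) :
  is_band mul ->
  mul (mul j (mul x y)) j = j <-> mul (mul j x) j = j /\ mul (mul j y) j = j.
Proof.
move=> [mulA idem]; rewrite !mulA; split=> [h|[hx hy]].
  have hx : mul (mul j x) (mul (mul (mul j x) y) j) = mul (mul (mul j x) y) j.
    by rewrite -(mulA (mul j x) y j) (mulA (mul j x) (mul j x)) idem.
  have hy : mul (mul (mul (mul j x) y) j) (mul y j) = mul (mul (mul j x) y) j.
    by rewrite -(mulA (mul j x) y j) -mulA idem.
  by split; [move: hx; rewrite h | move: hy; rewrite h mulA].
(* with [w = y j x], [j w = j x] and [w j = y j], so [j x y j = j w w j = j] *)
pose w := mul (mul y j) x.
have jw : mul j w = mul j x by rewrite /w !mulA hy.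
have wj : mul w j = mul y j by rewrite /w -2!mulA (mulA j) hx.
by rewrite -jw -(mulA (mul j w)) -wj -mulA (mulA w) idem mulA jw hx.
Qed.

Definition indic (R : realType) (P : Prop) : R[i] := if `[< P >] then 1 else 0.

Lemma indic1 (R : realType) (P : Prop) : P -> indic R P = 1.
Proof. by move=> p; rewrite /indic; case: asboolP. Qed.

Lemma indic0 (R : realType) (P : Prop) : ~ P -> indic R P = 0.
Proof. by move=> p; rewrite /indic; case: asboolP. Qed.

(** * Evaluating a virtual diagonal on indicator functions *)

Section IndicatorTests.
Variables (R : realType) (S : choiceType) (mul : S -> S -> S).
Local Notation E := (bfun R (option S * option S)).
Local Notation "x ** y" := (omul mul x y) (at level 40, left associativity).
Implicit Types (Q : option S -> option S -> Prop) (m : E -> R[i]).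

Definition indic_bfun Q : E := mkbfun (fun p => indic R (Q p.1 p.2)).

Lemma indic_bfunE Q x y : bval (indic_bfun Q) (x, y) = indic R (Q x y).
Proof.
rewrite (@mkbfunE _ _ _ 1) // => -[x' y'].
by rewrite /indic; case: asboolP; rewrite ?normc0 ?normc1.
Qed.

Lemma virtual_diagonal_shift m (s : S) Q1 Q2 Q : virtual_diagonal mul m ->
  (forall x y, Q1 x y <-> Q (Some s ** x) y) ->
  (forall x y, Q2 x y <-> Q x (y ** Some s)) ->
  m (indic_bfun Q1) = m (indic_bfun Q2).
Proof.
move=> [_ _ inv _] e1 e2; apply: (inv s (indic_bfun Q)) => x y.
  by rewrite !indic_bfunE; congr indic; apply/propext.
by rewrite !indic_bfunE; congr indic; apply/propext.
Qed.

Lemma virtual_diagonal_prod m Q (P : option S -> Prop) :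
  virtual_diagonal mul m -> (forall x y, Q x y <-> P (x ** y)) ->
  m (indic_bfun Q) = indic R (P None).
Proof.
move=> [_ _ _ prod] e; apply: (prod (fun x => indic R (P x))) => x y.
by rewrite indic_bfunE; congr indic; apply/propext.
Qed.

Lemma virtual_diagonal_sum m (I : choiceType) (A : {fset I}) (F : I -> E) :
  virtual_diagonal mul m -> m (\sum_(i <- A) F i) = \sum_(i <- A) m (F i).
Proof.
move=> [lin _ _ _].
have m0 : m 0 = 0.
  by have := lin (-1) 0 0; rewrite scaler0 addr0 mulN1r addNr.
elim: (enum_fset A) => [|i r IH]; first by rewrite !big_nil.
by rewrite !big_cons -IH; have := lin 1 (F i) (\sum_(k <- r) F k); rewrite scale1r mul1r.
Qed.

Section Band.
Hypothesis bandS : is_band mul.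

Let oband : is_band (omul mul).
Proof. by split; [apply: omulA (proj1 bandS) | apply: omul_idem]. Qed.

(** One half of [j = k] for two elements generating the same ideal: were [jk] different from [k],
    one test would have both value 1 and value 0. *)
Lemma virtual_diagonal_left m (j k : S) : virtual_diagonal mul m ->
  mul (mul j k) j = j -> mul (mul k j) k = k -> mul j k = k.
Proof.
move=> vd jkj kjk; apply: contrapT => jk.
have [oA oI] := oband; set J := Some j; set K := Some k.
have JKJ : J ** K ** J = J by rewrite /J /K /= jkj.
have KJK : K ** J ** K = K by rewrite /J /K /= kjk.
have JK : J ** K <> K by move=> -[].
pose Q x y := x ** J = J /\ J ** y ** J = J.
have one : m (indic_bfun Q) = 1.
  (* Right translation by [j] fixes the test; left translation makes it the condition
     [j(xy)j = j]. *)
  transitivity (m (indic_bfun (fun x y => Q (J ** x) y))).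
    symmetry; apply: (virtual_diagonal_shift (s := j) (Q := Q)) => // x y.
    by rewrite /Q !oA -(oA _ J J) oI.
  rewrite (virtual_diagonal_prod (P := fun z => J ** z ** J = J)) //.
    by rewrite indic1 // omul1 oI.
  by move=> x y; rewrite band_sandwichM.
have : m (indic_bfun Q) = 0.
  (* Right translation by [k] also fixes the test, but left translation asks for [kxj = j], which
     gives [kj = j] and then [jk = kjk = k]. *)
  transitivity (m (indic_bfun (fun x y => Q (K ** x) y))).
    symmetry; apply: (virtual_diagonal_shift (s := k) (Q := Q)) => // x y.
    by rewrite /Q band_sandwichM //; split=> [[-> ->]|[-> [->]]].
  rewrite (virtual_diagonal_prod (P := fun=> False)) ?indic0 // => x y.
  split=> // -[KxJ _]; apply: JK.
  have KJ : K ** J = J by rewrite -{1}KxJ !oA oI KxJ.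
  by rewrite -{2}KJK KJ.
by rewrite one => /eqP; rewrite oner_eq0.
Qed.

(** The mirror image: the one-sided condition is now on [y], and left translations fix the test. *)
Lemma virtual_diagonal_right m (j k : S) : virtual_diagonal mul m ->
  mul (mul j k) j = j -> mul (mul k j) k = k -> mul k j = k.
Proof.
move=> vd jkj kjk; apply: contrapT => kj.
have [oA oI] := oband; set J := Some j; set K := Some k.
have JKJ : J ** K ** J = J by rewrite /J /K /= jkj.
have KJK : K ** J ** K = K by rewrite /J /K /= kjk.
have KJ : K ** J <> K by move=> -[].
pose Q x y := J ** x ** J = J /\ J ** y = J.
have one : m (indic_bfun Q) = 1.
  transitivity (m (indic_bfun (fun x y => Q x (y ** J)))).
    apply: (virtual_diagonal_shift (s := j) (Q := Q)) => // x y.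
    by rewrite /Q !oA oI.
  rewrite (virtual_diagonal_prod (P := fun z => J ** z ** J = J)) //.
    by rewrite indic1 // omul1 oI.
  by move=> x y; rewrite band_sandwichM // /Q oA.
have : m (indic_bfun Q) = 0.
  transitivity (m (indic_bfun (fun x y => Q x (y ** K)))).
    apply: (virtual_diagonal_shift (s := k) (Q := Q)) => // x y.
    by rewrite /Q band_sandwichM //; split=> [[-> ->]|[[_ ->] ->]].
  rewrite (virtual_diagonal_prod (P := fun=> False)) ?indic0 // => x y.
  split=> // -[_ JyK]; apply: KJ.
  have JK : J ** K = J by rewrite -{1}JyK -!oA oI JyK.
  by rewrite -{2}KJK -oA JK.
by rewrite one => /eqP; rewrite oner_eq0.
Qed.

Lemma virtual_diagonal_comm m : virtual_diagonal mul m ->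
  forall s t, mul s t = mul t s.
Proof.
move=> vd s t; have [mulA idem] := bandS.
have flip u v : mul (mul (mul u v) (mul v u)) (mul u v) = mul u v.
  by rewrite !mulA -(mulA u v v) idem -(mulA (mul u v) u u) idem -mulA idem.
have stt := virtual_diagonal_left vd (flip s t) (flip t s).
have tst := virtual_diagonal_right vd (flip s t) (flip t s).
by rewrite -(flip s t) -mulA tst stt.
Qed.

Lemma virtual_diagonal_finite m : (forall s t, mul s t = mul t s) ->
  virtual_diagonal mul m -> finite_set [set: S].
Proof.
move=> mulC vd; have [oA oI] := oband.
have oC x y : x ** y = y ** x by case: x y => [x|] [y|] //=; rewrite mulC.
apply: contrapT => infS; have [_ [K mK] _ _] := vd.
(* [X] is chosen with more than [|K|] elements; the absolute value is there because [K] carries no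
   sign. *)
have [X _ cardX] := infinite_set_fset (Num.truncn `|K|).+1 infS.
(* [above x s] is [s <= x] in the semilattice order; for [s] in [X], [near_s s x] makes [s] the
   greatest element of [X] below [x]. *)
pose above (x : option S) s := x ** Some s = Some s.
pose near_s s x := above x s /\ forall t, t \in X -> above x t -> above (Some s) t.
pose Q s x y := near_s s x /\ above y s.
have aboveM x y s : above (x ** y) s <-> above x s /\ above y s.
  rewrite /above; split=> [h|[hx hy]]; last by rewrite -oA hy hx.
  by split; rewrite -{1}h oA; [rewrite oA oI | rewrite (oC y) -(oA x) oI].
have mQ s : m (indic_bfun (Q s)) = 1.
  transitivity (m (indic_bfun (fun x y => above x s /\ above y s))).
    (* Everything below [sx] is below [s], so left translation makes the maximality automatic; right
       translation by [s] fixes the test. *)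
    symmetry; apply: (virtual_diagonal_shift (s := s) (Q := Q s)) => // x y.
      rewrite /Q /near_s; split=> [[hx hy]|[[/aboveM[_ hx] _]]] //.
      split=> //; split=> [|t _ /aboveM[]//].
      by apply/aboveM; rewrite /above oI.
    rewrite /Q; split=> [[hx hy]|[hx /aboveM[]]] //.
    by split=> //; apply/aboveM; rewrite /above oI.
  rewrite (virtual_diagonal_prod (P := fun z => above z s)) ?indic1 //.
  by move=> x y; rewrite aboveM.
have Q_disj s t x y : s \in X -> t \in X -> Q s x y -> Q t x y -> s = t.
  move=> sX tX [[xs hs] _] [[xt ht] _].
  have := hs t tX xt; have := ht s sX xs; rewrite /above oC => -> [].
  by [].
pose F := \sum_(s <- X) indic_bfun (Q s).
have FE x y : bval F (x, y) = \sum_(s <- X) indic R (Q s x y).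
  rewrite /F; elim/big_ind2: _ => //.
  - by move=> F1 c1 F2 c2 <- <-; rewrite bvalD.
  - by move=> s _; rewrite indic_bfunE.
have F1 : bnorm F <= 1.
  apply: bnorm_le => // -[x y]; rewrite FE.
  have [[s sX Qs]|noQ] := pselect (exists2 s, s \in X & Q s x y).
    rewrite (big_fsetD1 s) //= big1_fset ?addr0 ?indic1 ?normc1 // => t.
    rewrite !inE => /andP[/eqP ts tX] _; apply: indic0 => Qt.
    by apply: ts; apply: Q_disj Qt Qs.
  rewrite big1_fset ?normc0 // => t tX _; apply: indic0 => Qt.
  by apply: noQ; exists t.
have mF : m F = (#|` X|%:R)%:C%C.
  rewrite virtual_diagonal_sum // rmorph_nat (eq_bigr (fun=> 1)) //.
  by rewrite big_const_seq count_predT iter_addr_0.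
have := mK F; rewrite mF normc_real // => cardK.
have : #|` X|%:R <= `|K|.
  apply: le_trans cardK _; apply: le_trans (ler_norm _) _.
  by rewrite normrM ler_piMr // ger0_norm ?bnorm_ge0.
have : `|K| < (Num.truncn `|K|).+1%:R by exact: truncnS_gt.
move=> h1 h2; have := le_lt_trans h2 h1; rewrite ltr_nat ltnNge.
by rewrite cardX.
Qed.

End Band.
End IndicatorTests.

(** * Finite semilattices *)

Section BoundedLinear.
Variable R : realType.
Local Notation C := R[i].

Definition bounded_linear (V W : normedModType C) (f : V -> W) : Prop :=
  (forall (c : C) x y, f (c *: x + y) = c *: f x + f y) /\
  exists2 M : R, 0 <= M & forall x, `|f x| <= M%:C%C * `|x|.

(** A complex constant suffices: [c * |x|] dominates a norm, hence equals its own modulus. *)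
Lemma bounded_linear_bound (V W : normedModType C) (f : V -> W) (c : C) :
  (forall (c : C) x y, f (c *: x + y) = c *: f x + f y) ->
  (forall x, `|f x| <= c * `|x|) -> bounded_linear f.
Proof.
move=> lin fc; split=> //; exists (normc c); first exact: normc_ge0.
move=> x; apply: le_trans (fc x) _.
rewrite -norm_normc -[X in _ <= _ * X]normr_id -normrM ger0_norm //.
exact: le_trans (normr_ge0 _) (fc x).
Qed.

Lemma bounded_linear_comp (U V W : normedModType C) (f : V -> W) (g : U -> V) :
  bounded_linear f -> bounded_linear g -> bounded_linear (fun x => f (g x)).
Proof.
move=> [flin [M M0 fM]] [glin [N N0 gN]]; split=> [c x y|].
  by rewrite glin flin.
exists (M * N) => [|x]; first by rewrite mulr_ge0.
apply: le_trans (fM _) _; rewrite rmorphM -mulrA ler_wpM2l ?ler0c //.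
Qed.

Lemma bounded_linearB (V W : normedModType C) (f g : V -> W) :
  bounded_linear f -> bounded_linear g -> bounded_linear (fun x => f x - g x).
Proof.
move=> [flin [M M0 fM]] [glin [N N0 gN]]; split=> [c x y|].
  by rewrite glin flin opprD addrACA scalerBr.
exists (M + N) => [|x]; first by rewrite addr_ge0.
by apply: le_trans (ler_normB _ _) _; rewrite rmorphD mulrDl lerD.
Qed.

Lemma bounded_linearD (V W : normedModType C) (f g : V -> W) :
  bounded_linear f -> bounded_linear g -> bounded_linear (fun x => f x + g x).
Proof.
move=> [flin [M M0 fM]] [glin [N N0 gN]]; split=> [c x y|].
  by rewrite glin flin addrACA scalerDr.
exists (M + N) => [|x]; first by rewrite addr_ge0.
by apply: le_trans (ler_normD _ _) _; rewrite rmorphD mulrDl lerD.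
Qed.

Lemma bounded_linear0 (V W : normedModType C) :
  bounded_linear (fun _ : V => 0 : W).
Proof.
split=> [c x y|]; first by rewrite scaler0 addr0.
by exists 0 => // x; rewrite normr0 mul0r.
Qed.

(* [d s] is a derivation into the dual of [V]; its values on the commuting
   idempotents of a list are made inner one element at a time: if [d] already
   vanishes on the previous ones, then [p.d(p) - d(p).p] implements [d] at [p]
   and commutes with them. *)
Lemma semilattice_derivation_inner (S : eqType) (mul : S -> S -> S)
    (V : normedModType C) (L P : S -> V -> V) (d : S -> V -> C^o) :
  (forall s, mul s s = s) -> (forall s t, mul s t = mul t s) ->
  (forall s t x, L (mul s t) x = L s (L t x)) ->
  (forall s t x, P (mul s t) x = P t (P s x)) ->
  (forall s t x, L s (P t x) = P t (L s x)) ->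
  (forall s, bounded_linear (L s)) -> (forall s, bounded_linear (P s)) ->
  (forall s, bounded_linear (d s)) ->
  (forall s t x, d (mul s t) x = d t (P s x) + d s (L t x)) ->
  forall r : seq S, exists2 phi : V -> C^o, bounded_linear phi &
    forall s x, s \in r -> d s x = phi (P s x) - phi (L s x).
Proof.
move=> idem mulC LM PM LP Lb Pb db dM; elim=> [|p r [phi phib IH]].
  by exists (fun=> 0) => //; apply: bounded_linear0.
pose e s x := d s x - (phi (P s x) - phi (L s x)).
have eM s t x : e (mul s t) x = e t (P s x) + e s (L t x).
  by rewrite /e dM PM LM LP; ring.
have e0 s x : s \in r -> e s x = 0 by move=> sr; rewrite /e -IH // subrr.
have eb s : bounded_linear (e s).
  by do ![apply: bounded_linearB => //]; apply: bounded_linear_comp.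
have PP x : P p (P p x) = P p x by rewrite -PM idem.
have LL x : L p (L p x) = L p x by rewrite -LM idem.
(* For a derivation at an idempotent, p.e(p).p = 0. *)
have eLP x : e p (L p (P p x)) = 0.
  have := eM p p (P p x); rewrite idem PP => h.
  by apply: (addrI (e p (P p x))); rewrite -h addr0.
exists (fun x => phi x + (e p (P p x) - e p (L p x))).
  apply: bounded_linearD => //.
  by apply: bounded_linearB; apply: bounded_linear_comp.
move=> s x; rewrite inE => /orP[/eqP ->|sr].
  have ep : e p x = e p (P p x) + e p (L p x) by rewrite -eM idem.
  have -> : d p x = e p x + (phi (P p x) - phi (L p x)) by rewrite /e subrK.
  by rewrite PP LL -LP eLP ep; ring.
(* As [e] vanishes at [s], the two sides are [e] at [sp] and at [ps]; so e(p) commutes with [s]. *)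
have esw y : e p (P s y) = e p (L s y).
  have := eM s p y; rewrite (e0 s) // addr0 => <-.
  by rewrite mulC eM (e0 s) // add0r.
rewrite IH //.
have -> : e p (P p (P s x)) = e p (P p (L s x)).
  by rewrite -PM mulC PM esw LP.
have -> : e p (L p (P s x)) = e p (L p (L s x)).
  by rewrite LP esw -!LM mulC.
by ring.
Qed.

End BoundedLinear.

(** * Amenability over a finite semilattice *)

Section FiniteSemilattice.
Variables (R : realType) (S : choiceType) (mul : S -> S -> S) (omega : S -> R).
Local Notation C := R[i].

Lemma l1_conv_point_mass (s t : S) :
  l1_conv mul (point_mass R s) (point_mass R t) = point_mass R (mul s t).
Proof.
apply/funext => u; rewrite /l1_conv (@net_sum1 _ _ _ (s, t)) /=.
  by rewrite /point_mass !eqxx mulr1 eq_sym.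
move=> [s' t'] /= ne; rewrite /point_mass; case: eqP => // _.
case: eqP => [es|_]; last by rewrite mul0r.
case: eqP => [et|_]; last by rewrite mulr0.
by rewrite es et eqxx in ne.
Qed.

Lemma finite_in_l1w (a : S -> C) : finite_set [set: S] -> in_l1w omega a.
Proof.
move=> finS; pose X := fset_set [set: S].
exists (\sum_(s <- X) normc (a s) * `|omega s|) => J.
rewrite partial_sumE.
apply: (@le_trans _ _ (\sum_(s <- J) normc (a s) * `|omega s|)%:C%C).
  rewrite rmorph_sum; apply: ler_sum => s _.
  by rewrite /wabs norm_normc -rmorphM lecR ler_wpM2l ?normc_ge0 ?ler_norm.
rewrite lecR; apply: ler_sum_fset_subset => [s|].
  by rewrite mulr_ge0 ?normc_ge0.
by apply/fsubsetP => s _; rewrite in_fset_set // mem_setT.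
Qed.

(** The point masses span; they are added one at a time along a duplicate-free list. *)
Lemma finite_l1_ext (Phi : (S -> C) -> C) : finite_set [set: S] ->
  (forall (c : C) a b, Phi (l1_add (l1_scale c a) b) = c * Phi a + Phi b) ->
  (forall s, Phi (point_mass R s) = 0) -> forall a, Phi a = 0.
Proof.
move=> finS lin Phi0 a.
pose restr (r : seq S) s := if s \in r then a s else 0.
suff PhiR r : uniq r -> Phi (restr r) = 0.
  rewrite -(PhiR (fset_set [set: S])) ?fset_uniq //; congr Phi.
  by apply/funext => s; rewrite /restr in_fset_set // mem_setT.
elim: r => [_|s r IH /= /andP[sr ur]].
  have := lin (-1) (restr [::]) (restr [::]); rewrite mulN1r addNr => <-.
  congr Phi; apply/funext => s.
  by rewrite /l1_add /l1_scale /restr in_nil mulr0 addr0.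
have := lin (a s) (point_mass R s) (restr r).
rewrite Phi0 mulr0 add0r IH // => <-; congr Phi; apply/funext => t.
rewrite /restr /l1_add /l1_scale /point_mass inE.
by case: eqP => [->|_]; rewrite ?(negbTE sr) ?mulr1 ?addr0 // mulr0 add0r.
Qed.

Lemma finite_semilattice_amenable :
  finite_set [set: S] -> is_semilattice mul -> l1_amenable mul omega.
Proof.
move=> finS [[mulA idem] mulC] E la ra [mlin alin assoc [M mbound]] D.
move=> [Dlin Dalin Dder [N Dbound]].
have l1 a : in_l1w omega a by apply: finite_in_l1w.
pose delta (s : S) := point_mass R s.
have lab s : bounded_linear (la (delta s)).
  apply: (bounded_linear_bound (c := M%:C%C * l1w_norm omega (delta s))).
    by move=> c x y; have [] := mlin _ (l1 (delta s)) c x y.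
  by move=> x; have [] := mbound _ (l1 (delta s)) x.
have rab s : bounded_linear (fun x => ra x (delta s)).
  apply: (bounded_linear_bound (c := M%:C%C * l1w_norm omega (delta s))).
    by move=> c x y; have [] := mlin _ (l1 (delta s)) c x y.
  by move=> x; have [] := mbound _ (l1 (delta s)) x.
have Db s : bounded_linear (D (delta s) : E -> C^o).
  apply: (bounded_linear_bound (c := N%:C%C * l1w_norm omega (delta s))).
    by move=> c x y; apply: Dlin.
  by move=> x; apply: Dbound.
have [||||phi [philin [K K0 phiK]] phiE] :=
  @semilattice_derivation_inner R S mul E (fun s => la (delta s))
    (fun s x => ra x (delta s)) (fun s => D (delta s)) idem mulC _ _ _ lab rab Db _
    (fset_set [set: S]).
- move=> s t x; rewrite /delta -l1_conv_point_mass.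
  by have [] := assoc _ _ (l1 (delta s)) (l1 (delta t)) x.
- move=> s t x; rewrite /delta -l1_conv_point_mass.
  by have [] := assoc _ _ (l1 (delta s)) (l1 (delta t)) x.
- by move=> s t x; have [] := assoc _ _ (l1 (delta s)) (l1 (delta t)) x.
- by move=> s t x; rewrite /delta -l1_conv_point_mass Dder.
exists phi; split=> //; split; first by exists K.
(* For fixed [x] the difference of the two sides is linear in [a] and vanishes on point masses. *)
move=> a _ x; apply/eqP; rewrite -subr_eq0; apply/eqP; move: a.
apply: finite_l1_ext => // [c a b|s].
  rewrite Dalin //; have [-> ->] := alin _ _ (l1 a) (l1 b) c x.
  by rewrite !philin /GRing.scale /=; ring.
by rewrite (phiE s x) ?subrr // in_fset_set // mem_setT.
Qed.

End FiniteSemilattice.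

(** * The relation tau in a band, and the equivalences *)

(** From [uv = u(vu)v], the elements [uv] and [vu] are always tau-related. Conversely, if the
    product commutes, [v] in the ideal of [u] means [uv = v], so tau-related [s] and [t] satisfy
    [s = ts = st = t]. *)
Lemma tau_singletons_comm (S : Type) (mul : S -> S -> S) :
  is_band mul -> tau_classes_singletons mul <-> forall s t, mul s t = mul t s.
Proof.
move=> [mulA idem]; split=> [tau s t|mulC s t st].
  have sub u v : principal_ideal mul (mul u v) `<=` principal_ideal mul (mul v u).
    have uv : mul u v = mul (mul u (mul v u)) v by rewrite mulA -mulA idem.
    move=> w [->|[[a ->]|[[b ->]|[a [b ->]]]]]; do 3 right.
    - by exists u, v.
    - by exists (mul a u), v; rewrite uv !mulA.
    - by exists u, (mul v b); rewrite uv !mulA.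
    - by exists (mul a u), (mul v b); rewrite uv !mulA.
  by apply: tau; apply/seteqP; split; apply: sub.
have below u v : principal_ideal mul u v -> mul u v = v.
  move=> [->|[[a ->]|[[b ->]|[a [b ->]]]]].
  - exact: idem.
  - by rewrite mulC -mulA idem.
  - by rewrite mulA idem.
  - by rewrite mulA (mulC u) -(mulA a) idem.
have self u : principal_ideal mul u u by left.
have ts : principal_ideal mul t s by rewrite -st.
have ss : principal_ideal mul s t by rewrite st.
by rewrite -(below _ _ ts) mulC below.
Qed.

Lemma amenable_finite_semilattice (R : realType) (S : choiceType)
    (mul : S -> S -> S) (omega : S -> R) :
  is_band mul -> is_weight mul omega -> l1_amenable mul omega ->
  finite_set [set: S] /\ is_semilattice mul.
Proof.
move=> bandS weight.
move=> /(amenable_virtual_diagonal (proj1 bandS) (band_weight_ge1 bandS weight)).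
move=> [m vd]; have mulC := virtual_diagonal_comm bandS vd.
by split; [apply: virtual_diagonal_finite vd | split].
Qed.

Theorem theorem2p6 (R : realType) (S : choiceType) (mul : S -> S -> S)
  (omega : S -> R) :
  is_band mul -> is_weight mul omega ->
  [<-> l1_amenable mul omega;
       finite_set [set: S] /\ tau_classes_singletons mul;
       l1_amenable mul (fun _ : S => 1 : R);
       finite_set [set: S] /\ is_semilattice mul].
Proof.
move=> bandS weight; have comm := tau_singletons_comm bandS.
have weight1 : is_weight mul (fun _ : S => 1 : R).
  by split=> [s|s t]; rewrite ?ltr01 ?mulr1.
tfae.
- move=> /(amenable_finite_semilattice bandS weight) [finS [_ mulC]].
  by split=> //; apply/comm.
- move=> [finS /comm mulC].
  by apply: finite_semilattice_amenable.
- exact: amenable_finite_semilattice.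
- by move=> [finS semS]; apply: finite_semilattice_amenable.
Qed.
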